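(* The Hausdorff distance between the Markov spectrum $M$ and the Lagrange spectrum $L$ is at least $\delta_0$, where $$\delta_0=\frac{272052036746460995-3973474319367040\sqrt{87}-2762049221999040\sqrt{18229}+353887557067187\sqrt{151905}}{226488036203921280}\approx 9.1094243388\times 10^{-8}.$$
   Context: For a bi-infinite sequence $S=(S_n)_{n\in\mathbb{Z}}$ of positive integers and $k\in\mathbb{Z}$, put $\lambda_k(S)=[S_k;S_{k+1},S_{k+2},\dots]+[0;S_{k-1},S_{k-2},\dots]$ (continued fractions), $m(S)=\sup_{k\in\mathbb{Z}}\lambda_k(S)$ and $l(S)=\limsup_{k\to+\infty}\lambda_k(S)$. The Markov spectrum is $M=\{m(S): m(S)<\infty\}$ and the Lagrange spectrum is $L=\{l(S): l(S)<\infty\}$, where $S$ ranges over all bi-infinite sequences of positive integers (Perron's description of the classical spectra). One has $L\subset M$, both closed in $\mathbb{R}$. Since $L\subset M$, the Hausdorff distance is $d_H(L,M)=\sup_{m\in M\setminus L}d(L,m)$, where $d(L,m)=\inf_{x\in L}|x-m|$. *)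

(* Defs.v *)
From mathcomp Require Import all_boot all_order all_algebra.
From mathcomp Require Import all_classical all_reals all_analysis.

Set Implicit Arguments.
Unset Strict Implicit.
Unset Printing Implicit Defensive.

Import Order.TTheory GRing.Theory Num.Theory.
Import numFieldNormedType.Exports.

Local Open Scope classical_set_scope.
Local Open Scope ring_scope.

(* The n-th convergent [a 0; a 1, ..., a n]. *)
Fixpoint cf_convergent (R : realType) (a : nat -> nat) (n : nat) : R :=
  match n with
  | 0%N => (a 0%N)%:R
  | n'.+1 => (a 0%N)%:R + (cf_convergent R (fun i => a i.+1) n')^-1
  end.

(* The convergents do converge when a i > 0 for all i > 0, which is the case
   in the definition of perron_lambda on sequences of positive integers. *)
Definition continued_fraction (R : realType) (a : nat -> nat) : R :=
  limn (cf_convergent R a).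

Definition perron_lambda (R : realType) (u : int -> nat) (k : int) : R :=
  continued_fraction R (fun i => u (k + i%:Z))
  + continued_fraction R (fun i => if i is j.+1 then u (k - (j.+1)%:Z) else 0%N).

Definition markov_value (R : realType) (u : int -> nat) : \bar R :=
  ereal_sup (range (fun k : int => (perron_lambda R u k)%:E)).

Definition lagrange_value (R : realType) (u : int -> nat) : \bar R :=
  limn_esup (fun k : nat => (perron_lambda R u k%:Z)%:E).

Definition positive_sequence (u : int -> nat) : Prop :=
  forall k, (0 < u k)%N.

Definition markov_spectrum (R : realType) : set R :=
  [set x | exists u, positive_sequence u /\ markov_value R u = x%:E].

Definition lagrange_spectrum (R : realType) : set R :=
  [set x | exists u, positive_sequence u /\ lagrange_value R u = x%:E].

Arguments markov_spectrum R : clear implicits.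
Arguments lagrange_spectrum R : clear implicits.

Definition set_dist (R : realType) (A : set R) (y : R) : \bar R :=
  ereal_inf [set `|x - y|%:E | x in A].

Definition hausdorff_dist (R : realType) (A B : set R) : \bar R :=
  Order.max (ereal_sup [set set_dist B x | x in A])
            (ereal_sup [set set_dist A y | y in B]).

(* The one-sided formula for nested sets; the last hypothesis is there because
   the supremum of the empty set is -oo in \bar R. *)
Lemma hausdorff_dist_subset (R : realType) (A B : set R) :
  A `<=` B -> A !=set0 -> B `\` A !=set0 ->
  hausdorff_dist A B = ereal_sup [set set_dist A y | y in B `\` A].
Proof.
have dist_ge0 (C : set R) z : (0 <= set_dist C z)%E.
  by apply: le_ereal_inf_tmp => _ [x _ <-]; rewrite lee_fin.
have dist0 (C : set R) z : C z -> set_dist C z = 0%E.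
  move=> Cz; apply/eqP; rewrite eq_le dist_ge0 andbT.
  by apply: ereal_inf_lbound; exists z => //; rewrite subrr normr0.
move=> AB _ [b [Bb nAb]].
pose s := ereal_sup [set set_dist A y | y in B `\` A]; rewrite -/s.
have s0 : (0 <= s)%E.
  apply: (le_trans (dist_ge0 A b)).
  by apply: ereal_sup_ubound; exists b.
rewrite /hausdorff_dist.
have -> : ereal_sup [set set_dist A y | y in B] = s.
  apply/eqP; rewrite eq_le; apply/andP; split.
    apply: ge_ereal_sup => _ [y By <-].
    have [Ay|nAy] := pselect (A y); first by rewrite dist0.
    by apply: ereal_sup_ubound; exists y.
  by apply: ge_ereal_sup => _ [y [By _] <-]; apply: ereal_sup_ubound; exists y.
apply/max_idPr; apply: ge_ereal_sup => _ [x Ax <-].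
by rewrite dist0 //; apply: AB.
Qed.

(* The large literals are kept as unevaluated decimal numerals of nat; do not
   let simplification expand them to unary. *)
Definition delta0 (R : realType) : R :=
  (272052036746460995%:R
   - 3973474319367040%:R * Num.sqrt 87%:R
   - 2762049221999040%:R * Num.sqrt 18229%:R
   + 353887557067187%:R * Num.sqrt 151905%:R)
  / 226488036203921280%:R.

(* Main.v *)
(** Let p = 1 2 2 2 1 2 1 1 2 1 1 2.  The point of M is lambda_0 of the sequence
  [theta], which to the right of its centre is periodic with period 2112221 and
  to the left eventually periodic with period 6.  Suppose that some l(u) lies at
  distance less than delta0 from it, i.e. in the interval (alpha, beta), where
  beta = 2 + [0; 1, p, p, ...] + [0; 1222112 1222112 122, p, p, ...].
  A finite search over words in the letters 1 and 2 shows that around every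
  far enough k with lambda_k(u) > alpha the sequence reads, up to reversal,
  - (Q) 2212112221 2* 112221211222, or
  - (A) 22121122212112221 2* 1 p,
  where 2* is the letter at k.  In case (A) both sides of k continue no better
  than by p, p, ..., because a deviation which would decrease lambda_k creates a
  word that forces some lambda_j above beta; so lambda_k >= beta in the limit.
  In case (Q) the word at k + 7 is again of type (Q) or (A), so of type (Q), and
  by induction u is periodic to the right of k.  Along that period all lambda_j
  are below alpha.  Given three far apart indices with lambda_k > alpha, the
  middle one thus excludes one of the outer two: the right one in case (Q), the
  left one when the word is reversed. *)
Require Import Defs.
From Stdlib Require Import BinNums BinNat Nnat.
From mathcomp Require Import all_boot all_order all_algebra.
From mathcomp Require Import all_classical all_reals all_analysis.
From mathcomp Require Import ring lra zify.

Set Implicit Arguments.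
Unset Strict Implicit.
Unset Printing Implicit Defensive.

Import Order.TTheory GRing.Theory Num.Theory.
Import numFieldNormedType.Exports.

Local Open Scope classical_set_scope.
Local Open Scope ring_scope.

(** * Continued fractions as limits of words *)

Definition cf_tail (R : realType) (s : nat -> nat) : R :=
  continued_fraction R (fun i => if i is j.+1 then s j else 0%N).

(** The value $[0; l_1, \dots, l_n + t]$, where [t] stands for the part of the expansion not yet
    read. *)
Fixpoint cf_word (R : realType) (l : seq nat) (t : R) : R :=
  if l is a :: l' then (a%:R + cf_word l' t)^-1 else t.

Definition positive_word (l : seq nat) : bool := all (leq 1) l.

Lemma mkseq_cons (s : nat -> nat) n :
  mkseq s n.+1 = s 0%N :: mkseq (fun i => s i.+1) n.
Proof. by rewrite /mkseq /= (iotaDl 1 0) -map_comp. Qed.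

Lemma mkseq_cat (s : nat -> nat) m n :
  mkseq s (m + n) = mkseq s m ++ mkseq (fun i => s (m + i)%N) n.
Proof.
elim: m s => [//|m IH] s.
by rewrite addSn !mkseq_cons IH.
Qed.

Lemma eq_cf_tail (R : realType) (s s' : nat -> nat) :
  s =1 s' -> cf_tail R s = cf_tail R s'.
Proof. by move=> /funext ->. Qed.

Section word.
Variable R : realType.
Implicit Types (l : seq nat) (s : nat -> nat) (t x y : R).

Lemma cf_word_cat l l' t : cf_word (l ++ l') t = cf_word l (cf_word l' t).
Proof. by elim: l => //= a l ->. Qed.

Lemma cf_word_ge0 l t : 0 <= t -> 0 <= cf_word l t.
Proof. by move=> t0; elim: l => //= a l IH; rewrite invr_ge0 addr_ge0. Qed.

Lemma cf_word_le1 l t : positive_word l -> 0 <= t <= 1 -> cf_word l t <= 1.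
Proof.
case: l => [|a l] /=; first by move=> _ /andP[].
move=> /andP[a1 _] /andP[t0 _]; have := cf_word_ge0 l t0; have : 1 <= a%:R :> R by rewrite ler1n.
by move=> ? ?; rewrite invf_le1; lra.
Qed.

(** Each letter acts by the decreasing map $t \mapsto 1/(a+t)$, so the parity of the length decides
    the direction. *)
Lemma cf_word_mono l x y : positive_word l -> 0 <= x -> x <= y ->
  if odd (size l) then cf_word l y <= cf_word l x
  else cf_word l x <= cf_word l y.
Proof.
move=> + x0 xy; have y0 := le_trans x0 xy; elim: l => [//|a l IH] /= /andP[a1 /IH].
have H t : 0 <= t -> 0 < a%:R + cf_word l t.
  by move=> t0; rewrite ltr_pwDl ?cf_word_ge0 // ltr0n.
by case: (odd _) => /= h; rewrite lef_pV2 ?posrE ?H // lerD2l.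
Qed.

(** A single letter is only nonexpanding, as $1/(1+t)$ has slope $-1$ at 0; every pair of letters
    gains a factor $1/4$. *)
Lemma cf_word_contract n l x y : positive_word l -> (n.*2 <= size l)%N ->
  0 <= x -> 0 <= y -> `|cf_word l x - cf_word l y| <= `|x - y| * 4^-1 ^+ n.
Proof.
have step a u v : (0 < a)%N -> 0 <= u -> 0 <= v ->
    `|(a%:R + u)^-1 - (a%:R + v)^-1| <= `|u - v| :> R.
  move=> a0 u0 v0.
  have a1 : 1 <= a%:R :> R by rewrite ler1n.
  have -> : (a%:R + u)^-1 - (a%:R + v)^-1 =
            (v - u) / ((a%:R + u) * (a%:R + v)) by field; lra.
  rewrite normrM distrC ler_piMr // ger0_norm ?invr_ge0; last by nra.
  by rewrite invf_le1; nra.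
elim: n l => [|n IH] l.
  rewrite expr0 mulr1 => + _ x0 y0; elim: l => [//|a l IH] /= /andP[a0 /IH].
  by apply: le_trans; apply: step; rewrite ?cf_word_ge0.
case: l => [//|a [//|b l]] /=; rewrite doubleS !ltnS => /and3P[a0 b0 pl] sl x0 y0.
have := IH l pl sl x0 y0.
have := cf_word_ge0 l x0; have := cf_word_ge0 l y0.
move: (cf_word l x) (cf_word l y) => u v v0 u0 h.
have a1 : 1 <= a%:R :> R by rewrite ler1n.
have b1 : 1 <= b%:R :> R by rewrite ler1n.
have ab : 1 <= a%:R * b%:R :> R by rewrite -natrM ler1n muln_gt0 a0.
have au : 0 <= a%:R * u by apply: mulr_ge0 => //; lra.
have av : 0 <= a%:R * v by apply: mulr_ge0 => //; lra.
(* Both factors of the new denominator are at least $ab + 1 \ge 2$. *)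
have -> : (a%:R + (b%:R + u)^-1)^-1 - (a%:R + (b%:R + v)^-1)^-1 =
          (u - v) / ((a%:R * (b%:R + u) + 1) * (a%:R * (b%:R + v) + 1)).
  field.
  by apply/and4P; split; rewrite ?mulrDr; apply/eqP; lra.
rewrite exprSr mulrA normrM; apply: ler_pM => //.
rewrite ger0_norm ?invr_ge0; last first.
  by rewrite mulr_ge0 // !mulrDr; lra.
rewrite lef_pV2 ?posrE //; last first.
  by rewrite mulr_gt0 // !mulrDr; lra.
have -> : 4 = 2 * 2 :> R by ring.
by apply: ler_pM => //; rewrite !mulrDr; lra.
Qed.

Lemma cf_convergent_word s n :
  cf_convergent R (fun i => if i is j.+1 then s j else 0%N) n =
  cf_word (mkseq s n) 0.
Proof.
elim: n s => [//|n IH] s; rewrite mkseq_cons /= add0r -IH; congr (_^-1).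
by case: n {IH} => [|n] /=; rewrite ?addr0 ?add0r.
Qed.

Lemma positive_mkseq s n : (forall i, 0 < s i)%N -> positive_word (mkseq s n).
Proof. by move=> s0; apply/allP => _ /mapP[i _ ->]. Qed.

(** Truncations beyond $2n$ letters share their first $2n$ letters, hence stay within $4^{-n}$ of
    the $2n$-th one: the sequence is Cauchy. *)
Lemma cf_word_mkseq_cvg s : (forall i, 0 < s i)%N ->
  cvgn (fun n => cf_word (mkseq s n) 0 : R).
Proof.
move=> s0; apply: cauchy_cvg; apply: cauchy_exP => e e0.
have [n ne] : exists n, (4^-1 : R) ^+ n < e.
  have q : `|4^-1 : R| < 1 by rewrite ger0_norm; lra.
  have /cvgrPdist_lt /(_ e e0) [n _ /(_ n (leqnn n))] := cvg_expr q.
  rewrite sub0r normrN ger0_norm ?exprn_ge0 ?invr_ge0 // => h.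
  by exists n.
exists (cf_word (mkseq s n.*2) 0); exists n.*2 => // m /= nm.
rewrite /ball /= -(subnKC nm) mkseq_cat cf_word_cat.
set t := cf_word _ _.
set t' : R := cf_word (mkseq _ (m - n.*2)) 0.
have t0 : 0 <= t' by rewrite cf_word_ge0.
have t1 : t' <= 1 by rewrite cf_word_le1 ?positive_mkseq ?lexx //= ler01.
have := @cf_word_contract n _ 0 t' (positive_mkseq n.*2 s0) _ (lexx _) t0.
rewrite size_mkseq => /(_ (leqnn _)) /le_lt_trans; apply.
apply: le_lt_trans ne; rewrite sub0r normrN ger0_norm // ler_piMl //.
Qed.

Lemma cf_tailE s : cf_tail R s = limn (fun n => cf_word (mkseq s n) 0 : R).
Proof.
by rewrite /cf_tail /continued_fraction (funext (cf_convergent_word s)).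
Qed.

Lemma cf_tail_itv s : (forall i, 0 < s i)%N -> 0 <= cf_tail R s <= 1.
Proof.
move=> s0; rewrite cf_tailE; have c := cf_word_mkseq_cvg s0.
apply/andP; split; [apply: limr_ge => //|apply: limr_le => //]; near=> n.
  by rewrite cf_word_ge0.
by rewrite cf_word_le1 ?positive_mkseq // lexx ler01.
Unshelve. all: by end_near. Qed.

Lemma cf_tail_cons s : (forall i, 0 < s i)%N ->
  cf_tail R s = ((s 0%N)%:R + cf_tail R (fun i => s i.+1))^-1.
Proof.
move=> s0; have s0' i : (0 < s i.+1)%N by [].
rewrite cf_tailE; apply: cvg_lim => //.
rewrite -(cvg_shiftS (fun n => cf_word (mkseq s n) 0 : R)).
rewrite (_ : (fun n => _) =
  (fun n => ((s 0%N)%:R + cf_word (mkseq (fun i => s i.+1) n) 0)^-1 : R)).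
  apply: cvgV.
    rewrite gt_eqF // ltr_pwDl ?ltr0n //.
    by have /andP[] := cf_tail_itv s0'.
  by apply: cvgD; [exact: cvg_cst|rewrite cf_tailE; apply: cf_word_mkseq_cvg].
by apply/funext => n; rewrite mkseq_cons.
Qed.

Lemma cf_tail_word n s : (forall i, 0 < s i)%N ->
  cf_tail R s = cf_word (mkseq s n) (cf_tail R (fun i => s (n + i)%N)).
Proof.
elim: n s => [//|n IH] s s0.
rewrite mkseq_cons (cf_tail_cons s0) /=.
by rewrite (IH (fun i => s i.+1) (fun i => s0 i.+1)).
Qed.

End word.

Lemma perron_lambdaE (R : realType) (u : int -> nat) (k : int) :
  positive_sequence u ->
  perron_lambda R u k = (u k)%:R + cf_tail R (fun i => u (k + 1 + i%:Z))
                        + cf_tail R (fun i => u (k - 1 - i%:Z)).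
Proof.
move=> u0; rewrite /perron_lambda -/(cf_tail R (fun j => u (k - j.+1%:Z))).
have -> : cf_tail R (fun j => u (k - j.+1%:Z)) =
          cf_tail R (fun i => u (k - 1 - i%:Z)).
  by apply: eq_cf_tail => j; congr u; lia.
congr (_ + _); set s := fun i => u (k + 1 + i%:Z).
rewrite cf_tailE /continued_fraction; apply: cvg_lim => //.
have -> : cf_convergent R (fun i => u (k + i%:Z)) =
          (fun n => (u k)%:R + cf_word (mkseq s n) 0 : R).
  apply/funext => n; rewrite -cf_convergent_word.
  case: n => [|n] /=; rewrite ?addr0 // add0r; congr (_ + (_)^-1).
  by congr cf_convergent; apply/funext => i; rewrite /s; congr u; lia.
apply: cvgD; first exact: cvg_cst.
by apply: cf_word_mkseq_cvg => i; apply: u0.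
Qed.

(** * Rational bounds from finite windows *)

(** Fractions are pairs of binary naturals, so that [vm_compute] can run the searches in integer
    arithmetic. *)
Definition fracN (R : realType) (f : N * N) : R :=
  (N.to_nat f.1)%:R / (N.to_nat f.2)%:R.

Definition frac_add (f g : N * N) : N * N :=
  (N.add (N.mul f.1 g.2) (N.mul g.1 f.2), N.mul f.2 g.2).

Definition frac_le (f g : N * N) : bool :=
  N.leb (N.mul f.1 g.2) (N.mul g.1 f.2).

Definition frac_step (a : nat) (f : N * N) : N * N :=
  (f.2, N.add (N.mul (N.of_nat a) f.2) f.1).

(** Encloses [cf_word l t] for all [t] in $[0,1]$; the ends swap at each letter because $1/(a+t)$
    decreases. *)
Fixpoint word_bound (l : seq nat) : (N * N) * (N * N) :=
  if l is a :: l' then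
    let: (lo, hi) := word_bound l' in (frac_step a hi, frac_step a lo)
  else ((0%num, 1%num), (1%num, 1%num)).

(** The head of [r] is the central letter, so the bound is meaningful for nonempty [r]. *)
Definition window_low (l r : seq nat) : N * N :=
  frac_add (N.of_nat (head 0%N r), 1%num)
    (frac_add (word_bound l).1 (word_bound (behead r)).1).

Definition window_high (l r : seq nat) : N * N :=
  frac_add (N.of_nat (head 0%N r), 1%num)
    (frac_add (word_bound l).2 (word_bound (behead r)).2).

Definition bwd (u : int -> nat) (k : int) (i : nat) : nat := u (k - i%:Z).
Definition fwd (u : int -> nat) (k : int) (i : nat) : nat := u (k + i%:Z).
Definition flip (u : int -> nat) (i : int) : nat := u (- i).

(* Around position k the sequence reads rev l ++ r, with r starting at k: the
   list l is read outwards from k. *)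
Definition window (u : int -> nat) (k : int) (l r : seq nat) : Prop :=
  l = mkseq (bwd u (k - 1)) (size l) /\ r = mkseq (fwd u k) (size r).

Lemma N_to_natD a b : N.to_nat (N.add a b) = (N.to_nat a + N.to_nat b)%N.
Proof. exact: N2Nat.inj_add. Qed.

Lemma N_to_natM a b : N.to_nat (N.mul a b) = (N.to_nat a * N.to_nat b)%N.
Proof. exact: N2Nat.inj_mul. Qed.

Section frac.
Variable R : realType.

Definition posfrac (f : N * N) := (0 < N.to_nat f.2)%N.

Lemma frac_addE f g : posfrac f -> posfrac g ->
  posfrac (frac_add f g) /\ fracN R (frac_add f g) = fracN R f + fracN R g.
Proof.
rewrite /posfrac /fracN /= N_to_natD !N_to_natM => f0 g0.
rewrite muln_gt0 f0 g0 natrD !natrM; split=> //.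
by rewrite addf_div // pnatr_eq0 -lt0n.
Qed.

Lemma frac_leP f g : posfrac f -> posfrac g -> frac_le f g -> fracN R f <= fracN R g.
Proof.
rewrite /posfrac /fracN /frac_le /= => f0 g0 /N.leb_le h.
rewrite ler_pdivrMr ?ltr0n // mulrAC ler_pdivlMr ?ltr0n //.
by rewrite -!natrM ler_nat -!N_to_natM; lia.
Qed.

Lemma frac_stepE a f : (0 < a)%N -> posfrac f ->
  posfrac (frac_step a f) /\ fracN R (frac_step a f) = (a%:R + fracN R f)^-1.
Proof.
rewrite /posfrac /fracN /= N_to_natD N_to_natM Nat2N.id => a0 f0.
split; first by rewrite addn_gt0 muln_gt0 a0 f0.
have f1 : (N.to_nat f.2)%:R != 0 :> R by rewrite pnatr_eq0 -lt0n.
by rewrite natrD natrM -invf_div mulrDl mulfK.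
Qed.

Lemma word_boundP l (t : R) : positive_word l -> 0 <= t <= 1 ->
  [/\ posfrac (word_bound l).1, posfrac (word_bound l).2,
      0 <= fracN R (word_bound l).1 &
      fracN R (word_bound l).1 <= cf_word l t <= fracN R (word_bound l).2].
Proof.
move=> + t01; elim: l => [|a l IH] /=.
  by rewrite /fracN /= mul0r divr1.
move=> /andP[a0 /IH]; case: (word_bound l) => lo hi /= [plo phi lo0 /andP[h1 h2]].
have [p1 e1] := frac_stepE a0 plo; have [p2 e2] := frac_stepE a0 phi.
have a1 : 0 < a%:R :> R by rewrite ltr0n.
split=> //; first by rewrite e2 invr_ge0; lra.
by rewrite e1 e2 !lef_pV2 ?posrE; lra.
Qed.

End frac.

Lemma mkseq_catP (f : nat -> nat) a b :
  a ++ b = mkseq f (size (a ++ b)) -> a = mkseq f (size a).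
Proof.
rewrite size_cat mkseq_cat => /eqP; rewrite eqseq_cat ?size_mkseq //.
by case/andP => /eqP.
Qed.

Section window.
Variable u : int -> nat.
Implicit Types (k : int) (l r : seq nat).

Lemma window_sub k l r l' r' :
  prefix l' l -> prefix r' r -> window u k l r -> window u k l' r'.
Proof. by move=> /prefixP[x ->] /prefixP[y ->] [/mkseq_catP ? /mkseq_catP]. Qed.

Lemma window_head k l c r : window u k l (c :: r) -> c = u k.
Proof. by move=> [_]; rewrite /= mkseq_cons /fwd addr0 => -[]. Qed.

Lemma window_next k l c r :
  window u k l (c :: r) <-> window u (k + 1) (c :: l) r.
Proof.
rewrite /window /= !mkseq_cons.
have -> : (fun i => bwd u (k + 1 - 1) i.+1) = bwd u (k - 1).
  by apply/funext => i; rewrite /bwd; congr u; lia.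
have -> : (fun i => fwd u k i.+1) = fwd u (k + 1).
  by apply/funext => i; rewrite /fwd; congr u; lia.
have -> : bwd u (k + 1 - 1) 0 = fwd u k 0 by rewrite /bwd /fwd; congr u; lia.
by split=> [[<- [-> <-]]|[[-> <-] <-]].
Qed.

Lemma window_shiftR k l r n : (n <= size r)%N ->
  window u k l r -> window u (k + n%:Z) (rev (take n r) ++ l) (drop n r).
Proof.
elim: n k l r => [|n IH] k l r; first by rewrite addr0 take0 drop0.
case: r => [//|c r] /= nr /window_next /IH => /(_ nr).
by rewrite rev_cons cat_rcons; congr window; lia.
Qed.

Lemma window_shiftL k l r n : (n <= size l)%N ->
  window u k l r -> window u (k - n%:Z) (drop n l) (rev (take n l) ++ r).
Proof.
elim: n k l r => [|n IH] k l r; first by rewrite subr0 take0 drop0.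
case: l => [//|c l] /= nl; rewrite -[k in window u k](subrK 1) => /window_next /IH.
by rewrite rev_cons cat_rcons => /(_ nl); congr window; lia.
Qed.

Lemma window_extR k l r : window u k l r -> window u k l (rcons r (fwd u k (size r))).
Proof. by move=> [? er]; split; rewrite // size_rcons mkseqS -er. Qed.

Lemma window_extL k l r :
  window u k l r -> window u k (rcons l (bwd u (k - 1) (size l))) r.
Proof. by move=> [el ?]; split; rewrite // size_rcons mkseqS -el. Qed.

(** Reflection exchanges the two sides, but the central letter [c] has to stay at the head of the
    right word. *)
Lemma window_flip k l c r :
  window (flip u) (- k) l (c :: r) <-> window u k r (c :: l).
Proof.
rewrite /window /= !mkseq_cons /fwd /bwd /flip.
have -> : (fun i : nat => u (- (- k - 1 - i%:Z))) = (fun i : nat => u (k + i.+1%:Z)).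
  by apply/funext => i; congr u; lia.
have -> : (fun i : nat => u (- (- k + i.+1%:Z))) = (fun i : nat => u (k - 1 - i%:Z)).
  by apply/funext => i; congr u; lia.
rewrite !addr0 opprK.
by split=> [[<- [-> <-]]|[<- [-> <-]]].
Qed.

Hypothesis u_gt0 : positive_sequence u.

Lemma positive_window k l r : window u k l r -> positive_word l /\ positive_word r.
Proof. by move=> [-> ->]; split; apply: positive_mkseq => i; apply: u_gt0. Qed.

Lemma window_fwd (R : realType) k l r : window u k l r ->
  cf_tail R (fwd u k) = cf_word r (cf_tail R (fwd u (k + (size r)%:Z))).
Proof.
move=> [_ er]; rewrite (@cf_tail_word _ (size r)); last by move=> i; apply: u_gt0.
rewrite -er; congr cf_word; apply: eq_cf_tail => i; rewrite /fwd; congr u; lia.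
Qed.

Lemma window_bwd (R : realType) k l r : window u k l r ->
  cf_tail R (bwd u (k - 1)) =
  cf_word l (cf_tail R (bwd u (k - 1 - (size l)%:Z))).
Proof.
move=> [el _]; rewrite (@cf_tail_word _ (size l)); last by move=> i; apply: u_gt0.
rewrite -el; congr cf_word; apply: eq_cf_tail => i; rewrite /bwd; congr u; lia.
Qed.

Lemma lambdaE (R : realType) k :
  perron_lambda R u k =
  (u k)%:R + cf_tail R (fwd u (k + 1)) + cf_tail R (bwd u (k - 1)).
Proof. exact: perron_lambdaE. Qed.

Lemma window_bounds (R : realType) k l c r : window u k l (c :: r) ->
  [/\ posfrac (window_low l (c :: r)), posfrac (window_high l (c :: r)),
      fracN R (window_low l (c :: r)) <= perron_lambda R u k &
      perron_lambda R u k <= fracN R (window_high l (c :: r))].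
Proof.
move=> w; have [pl /= /andP[_ pr]] := positive_window w.
have /window_next w' := w.
rewrite lambdaE (window_fwd R w') (window_bwd R w) -(window_head w).
have t0 k' : 0 <= cf_tail R (fwd u k') <= 1 by apply: cf_tail_itv => i; apply: u_gt0.
have t1 k' : 0 <= cf_tail R (bwd u k') <= 1 by apply: cf_tail_itv => i; apply: u_gt0.
have [p1 p2 _ /andP[b1 b2]] := word_boundP pr (t0 (k + 1 + (size r)%:Z)).
have [p3 p4 _ /andP[b3 b4]] := word_boundP pl (t1 (k - 1 - (size l)%:Z)).
rewrite /window_low /window_high /=.
have pc : posfrac (N.of_nat c, 1%num) by [].
have ec : fracN R (N.of_nat c, 1%num) = c%:R.
  by rewrite /fracN /= Nat2N.id divr1.
have [q1 e1] := frac_addE R p3 p1; have [q2 e2] := frac_addE R p4 p2.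
have [q3 e3] := frac_addE R pc q1; have [q4 e4] := frac_addE R pc q2.
by split => //; rewrite ?e3 ?e4 ec ?e1 ?e2; lra.
Qed.

End window.

Lemma positive_flip u : positive_sequence u -> positive_sequence (flip u).
Proof. by move=> u0 k; apply: u0. Qed.

Lemma lambda_flip (R : realType) u k : positive_sequence u ->
  perron_lambda R (flip u) k = perron_lambda R u (- k).
Proof.
move=> u0; rewrite !lambdaE //; last exact: positive_flip.
rewrite /flip -!addrA; congr (_ + _); rewrite addrC.
by congr (_ + _); apply: eq_cf_tail => i; rewrite /bwd /fwd; congr u; lia.
Qed.

(** * Forbidden words and finite search *)

(* alpha_low < alpha and beta < beta_up, with alpha and beta as in the header. *)
Definition beta_up : N * N := (32930444820%num, 10000000000%num).
Definition alpha_low : N * N := (32930442992%num, 10000000000%num).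

(** Some position of the word has $\lambda \ge$ [beta_up] whatever surrounds the word; such a word
    cannot occur where all $\lambda_j$ are smaller. *)
Definition heavy (l r : seq nat) : bool :=
  let w := rev l ++ r in
  has (fun j => frac_le beta_up (window_low (rev (take j w)) (drop j w)))
      (iota 0 (size w)).

(* The nested conditionals, unlike || and &&, keep call-by-value evaluation
   from exploring the branches that are not needed. *)
Fixpoint search (leaf : seq nat -> seq nat -> bool) (sched : seq bool)
    (l r : seq nat) : bool :=
  if heavy l r then true else if leaf l r then true else
  if sched is d :: sched' then
    if d then
      if search leaf sched' l (rcons r 1%N) then search leaf sched' l (rcons r 2)
      else false
    else
      if search leaf sched' (rcons l 1%N) r then search leaf sched' (rcons l 2) r
      else false
  else false.

Definition good (R : realType) (u : int -> nat) (a b : int) : Prop :=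
  forall i, a <= i <= b ->
    (u i = 1%N \/ u i = 2%N) /\ perron_lambda R u i < fracN R beta_up.

Lemma good_sub (R : realType) u a b a' b' :
  a <= a' -> b' <= b -> good R u a b -> good R u a' b'.
Proof. by move=> ? ? g i ?; apply: g; lia. Qed.

Lemma good_flip (R : realType) u a b : positive_sequence u ->
  good R u a b -> good R (flip u) (- b) (- a).
Proof. by move=> u0 g i ?; rewrite lambda_flip //; apply: g; lia. Qed.

Section search.
Variables (R : realType) (u : int -> nat).
Hypothesis u_gt0 : positive_sequence u.

Lemma heavyP k l r : window u k l r -> heavy l r ->
  exists2 i : int, k - (size l)%:Z <= i < k + (size r)%:Z &
    fracN R beta_up <= perron_lambda R u i.
Proof.
move=> w /hasP[j]; rewrite mem_iota add0n size_cat size_rev => /andP[_ js] hj.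
exists (k - (size l)%:Z + j%:Z); first by lia.
have /window_shiftR w1 := window_shiftL (leqnn _) w.
move: w1; rewrite drop_size take_size => /(_ j); rewrite size_cat size_rev => /(_ (ltnW js)).
rewrite cats0; move: hj; case ed : (drop j (rev l ++ r)) => [|c r'].
  by have := congr1 size ed; rewrite size_drop size_cat size_rev /=; lia.
move=> hj w1; have [p1 _ h _] := window_bounds u_gt0 R w1.
by apply: le_trans h; apply: frac_leP.
Qed.

(** The actual letters of [u] trace one branch of the search tree. No heavy word occurs on it, so it
    ends in a leaf. The bound [b.+1] counts position [k], which belongs to [r]. *)
Lemma searchP leaf sched k l r a b :
  search leaf sched l r ->
  window u k l r -> good R u (k - a%:Z) (k + b%:Z) ->
  (size l + size sched <= a)%N -> (size r + size sched <= b.+1)%N ->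
  exists l' r', window u k l' r' /\ leaf l' r'.
Proof.
elim: sched l r => [|d sched IH] l r /= + w g la rb.
all: case: ifP => [/(heavyP w)[i ik hi]|_].
1,3: by have [] := g i; [lia|move=> _; rewrite ltNge hi].
all: case: ifP => [|_ //]; first by exists l, r.
case: d la rb => la rb; case: ifP => // s1 s2.
- have g1 := g (k + (size r)%:Z); have wx := window_extR w.
  have [|[e|e] _] := g1; first by move: rb; rewrite /=; lia.
    move: wx; rewrite /fwd e => wx.
    by apply: (IH _ _ _ wx g) => //; rewrite ?size_rcons; move: la rb => /=; lia.
  move: wx; rewrite /fwd e => wx.
  by apply: (IH _ _ _ wx g) => //; rewrite ?size_rcons; move: la rb => /=; lia.
- have g1 := g (k - 1 - (size l)%:Z); have wx := window_extL w.
  have [|[e|e] _] := g1; first by move: la; rewrite /=; lia.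
    move: wx; rewrite /bwd e => wx.
    by apply: (IH _ _ _ wx g) => //; rewrite ?size_rcons; move: la rb => /=; lia.
  move: wx; rewrite /bwd e => wx.
  by apply: (IH _ _ _ wx g) => //; rewrite ?size_rcons; move: la rb => /=; lia.
Qed.

End search.

(** * The words of types (Q) and (A), and the computed searches *)

Definition word_p : seq nat := [:: 1; 2; 2; 2; 1; 2; 1; 1; 2; 1; 1; 2]%N.
(** Left words are read outwards from the central letter; right words begin with it. *)
Definition Q_left : seq nat := [:: 1; 2; 2; 2; 1; 1; 2; 1; 2; 2]%N.
Definition Q_right : seq nat := [:: 2; 1; 1; 2; 2; 2; 1; 2; 1; 1; 2; 2; 2]%N.
Definition A_left : seq nat :=
  [:: 1; 2; 2; 2; 1; 1; 2; 1; 2; 2; 2; 1; 1; 2; 1; 2; 2]%N.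
Definition A_right : seq nat := [:: 2; 1]%N ++ word_p.

Definition Q_leaf (l r : seq nat) : bool := prefix Q_left l && prefix Q_right r.
Definition A_leaf (l r : seq nat) : bool := prefix A_left l && prefix A_right r.
Definition QA_leaf (l r : seq nat) : bool := Q_leaf l r || A_leaf l r.
(** The last alternative is the mirrored window, with the central letter moved across as in
    [window_flip]. *)
Definition central_leaf (l r : seq nat) : bool :=
  if r is c :: r' then
    [|| frac_le (window_high l r) alpha_low, QA_leaf l r | QA_leaf r' (c :: l)]
  else false.
(** The tail either continues with $p$ or is already at most $[0; p, p, \dots]$; three copies of $p$
    approximate that limit closely enough for a rational comparison. *)
Definition tail_leaf (_ r : seq nat) : bool :=
  prefix word_p r
  || frac_le (word_bound r).2 (word_bound (word_p ++ word_p ++ word_p)).1.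

Lemma search_central :
  search central_leaf (flatten (nseq 20 [:: true; false])) [::] [::].
Proof. by vm_compute. Qed.

(** Moving the centre of a (Q) window seven places to the right turns its left word into exactly
    [A_left], which extends [Q_left]; it remains to explore the right side. *)
Lemma search_step : search QA_leaf (nseq 14 true) A_left (drop 7 Q_right).
Proof. by vm_compute. Qed.

(** The first context is a $p$ just read; the second, seen after reflection, is the whole (A) word
    and starts the tail on its left. *)
Lemma search_tail (ctx : seq nat) : ctx = rev word_p \/ ctx = rev A_left ++ A_right ->
  search tail_leaf (nseq 24 true) ctx [::].
Proof. by case=> ->; vm_compute. Qed.

(** * Types of central words *)

Definition Q_at u k := window u k Q_left Q_right.
Definition A_at u k := window u k A_left A_right.

Lemma window_catR u k l a b :
  window u k l a -> window u (k + (size a)%:Z) [::] b -> window u k l (a ++ b).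
Proof.
move=> [el ea] [_ eb]; split=> //; rewrite size_cat mkseq_cat -ea; congr (_ ++ _).
by rewrite {1}eb; congr mkseq; apply/funext => i; rewrite /fwd; congr u; lia.
Qed.

Lemma QA_leafP u k l r : window u k l r -> QA_leaf l r -> Q_at u k \/ A_at u k.
Proof.
by move=> w /orP[]/andP[pl pr]; [left|right]; apply: window_sub pl pr w.
Qed.

Section local.
Variables (R : realType) (u : int -> nat).
Hypothesis u_gt0 : positive_sequence u.

Lemma central_types k : good R u (k - 40) (k + 40) ->
  fracN R alpha_low < perron_lambda R u k ->
  (Q_at u k \/ A_at u k) \/ (Q_at (flip u) (- k) \/ A_at (flip u) (- k)).
Proof.
move=> g hk.
have w0 : window u k [::] [::] by [].
have [l [[|c r] [w] //=]] :=
  searchP u_gt0 search_central w0 g isT isT.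
case/or3P => [h|h|h].
- have [_ p h1 h2] := window_bounds u_gt0 R w.
  by have := @frac_leP R _ alpha_low p isT h; rewrite leNgt (lt_le_trans hk h2).
- by left; apply: QA_leafP w h.
- by right; apply: QA_leafP h; apply/window_flip.
Qed.

Lemma Q_at_next k : good R u (k - 40) (k + 40) -> Q_at u k ->
  Q_at u (k + 7) \/ A_at u (k + 7).
Proof.
move=> g /(window_shiftR (isT : (7 <= size Q_right)%N)) w.
have g' : good R u (k + 7 - 31%:Z) (k + 7 + 20%:Z) by apply: good_sub g; lia.
have [l [r [w' h]]] := searchP u_gt0 search_step w g' isT isT.
exact: QA_leafP w' h.
Qed.

End local.

(** * Case (A): comparison with the tail p, p, .. *)

(** The number $Y = [0; p, p, \dots]$, the positive root of $237 t^2 + 444 t - 433 = 0$. *)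
Definition periodic_tail (R : realType) : R := (Num.sqrt 151905%:R - 222) / 237.

Section tail.
Variable R : realType.
Local Notation Y := (periodic_tail R).

Lemma sqrt_lower (a b : R) : 0 <= a -> a * a <= b -> a <= Num.sqrt b.
Proof.
move=> a0 ab; have b0 : 0 <= b by apply: le_trans ab; apply: mulr_ge0.
by rewrite -(ger0_norm a0) -sqrtr_sqr ler_sqrt // expr2.
Qed.

Lemma sqrt_upper (b c : R) : 0 <= c -> b <= c * c -> Num.sqrt b <= c.
Proof.
by move=> c0 bc; rewrite -(ger0_norm c0) -sqrtr_sqr ler_sqrt ?exprn_ge0 // expr2.
Qed.

Lemma sqrt_itv (a b c : R) : 0 <= a -> a * a <= b -> 0 <= c -> b <= c * c ->
  [/\ a <= Num.sqrt b, Num.sqrt b <= c & Num.sqrt b * Num.sqrt b = b].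
Proof.
move=> a0 ab c0 bc; split; [exact: sqrt_lower|exact: sqrt_upper|].
by rewrite -expr2 sqr_sqrtr //; apply: le_trans ab; apply: mulr_ge0.
Qed.

Lemma sqrt_151905 : let s : R := Num.sqrt 151905%:R in
  [/\ 389 <= s, s <= 390 & s * s = 151905%:R].
Proof. by apply: sqrt_itv; lra. Qed.

Lemma periodic_tail_itv : 0 <= Y <= 1.
Proof.
rewrite /periodic_tail; have [] := sqrt_151905; move: (Num.sqrt _) => s h1 h2 _.
by apply/andP; split; lra.
Qed.

Lemma word_p_mobius (t : R) : 0 <= t ->
  cf_word word_p t = (1732 + 671 * t) / (2447 + 948 * t).
Proof.
move=> t0 /=; field.
by repeat (apply/andP; split); apply/eqP; lra.
Qed.

Lemma periodic_tail_fix : cf_word word_p Y = Y.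
Proof.
have [Y0 Y1] := andP periodic_tail_itv; rewrite word_p_mobius //.
apply/(canLR (mulfK _)); first by apply/eqP; lra.
(* The equation is linear in [s] and [s * s], so the value of [s * s] settles it. *)
rewrite /periodic_tail; have [] := sqrt_151905; move: (Num.sqrt _) => s _ _ h3.
lra.
Qed.

Lemma A_left_value :
  cf_word A_left Y = (321405190311%:R + Num.sqrt 151905%:R) / 454284411513%:R.
Proof.
have [Y0 Y1] := andP periodic_tail_itv; rewrite -(cat_take_drop 8 A_left) cf_word_cat.
(* Cutting the word after eight letters keeps the coefficients of both Möbius maps at three
   digits. *)
have z0 : 0 <= cf_word (drop 8 A_left) Y by apply: cf_word_ge0.
have : cf_word (drop 8 A_left) Y =
    (5157615%:R + Num.sqrt 151905%:R) / 12476077%:R.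
  have -> : cf_word (drop 8 A_left) Y = (277 + 117 * Y) / (670 + 283 * Y).
    by rewrite /=; field; repeat (apply/andP; split); apply/eqP; lra.
  apply/(canLR (mulfK _)); first by apply/eqP; lra.
  by rewrite /periodic_tail; have [] := sqrt_151905; move: (Num.sqrt _) => s _ _ h3; lra.
move: (cf_word _ Y) z0 => z z0 hz.
have -> : cf_word (take 8 A_left) z = (104 + 75 * z) / (147 + 106 * z).
  by rewrite /=; field; repeat (apply/andP; split); apply/eqP; lra.
apply/(canLR (mulfK _)); first by apply/eqP; lra.
rewrite hz; have [] := sqrt_151905; move: (Num.sqrt _) => s h1 h2 h3.
lra.
Qed.

(** Since $p$ has even length it preserves order, which settles $v \le Y$; for $v > Y$ it contracts
    towards its fixed point $Y$. *)
Lemma fixpoint_upper (v e : R) : 0 <= v -> v <= Y + e -> 0 <= e ->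
  cf_word word_p v <= Y + e / 4.
Proof.
move=> v0 ve e0; have [Y0 _] := andP periodic_tail_itv.
have [vY|Yv] := leP v Y.
  have : cf_word word_p v <= cf_word word_p Y := cf_word_mono (l := word_p) isT v0 vY.
  by rewrite periodic_tail_fix; lra.
have := @cf_word_contract _ 1 word_p _ _ isT isT v0 Y0.
rewrite periodic_tail_fix expr1 (ger0_norm (_ : 0 <= v - Y)); last by lra.
by move=> h; have := ler_norm (cf_word word_p v - Y); lra.
Qed.

(** Odd words reverse order and do not expand, so an upper bound on the tail becomes a lower bound
    with the same error. *)
Lemma odd_word_lower l (v e : R) : positive_word l -> odd (size l) ->
  0 <= v -> v <= Y + e -> 0 <= e -> cf_word l Y - e <= cf_word l v.
Proof.
move=> pl ol v0 ve e0; have [Y0 _] := andP periodic_tail_itv.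
have [vY|Yv] := leP v Y.
  by have := cf_word_mono pl v0 vY; rewrite ol; lra.
have := @cf_word_contract _ 0 l _ _ pl isT Y0 v0.
rewrite expr0 mulr1 distrC (distrC Y) (ger0_norm (_ : 0 <= v - Y)); last by lra.
by rewrite distrC => h; have := ler_norm (cf_word l Y - cf_word l v); lra.
Qed.

(** By [search_tail], either the tail is already at most $Y$, or it reads $p$ and the induction
    applies twelve letters further on, with this $p$ as context and the error divided by 4. *)
Lemma tail_bound n u k ctx : positive_sequence u ->
  ctx = rev word_p \/ ctx = rev A_left ++ A_right ->
  window u k ctx [::] ->
  good R u (k - 60) (k + (12 * n)%N%:Z + 40) ->
  cf_tail R (fwd u k) <= Y + 4^-1 ^+ n.
Proof.
move=> u0; have V_itv k' : 0 <= cf_tail R (fwd u k') <= 1.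
  by apply: cf_tail_itv => i; apply: u0.
elim: n k ctx => [|n IH] k ctx hctx w g.
  by rewrite expr0; have /andP[_ h] := V_itv k; have /andP[? _] := periodic_tail_itv; lra.
(* The 31 letters of context and 24 searched letters fit into the margin 60. *)
have sctx : (size ctx <= 31)%N by case: hctx => ->.
have g' : good R u (k - 60%:Z) (k + 40%:Z) by apply: good_sub g; lia.
have [||l [r [w' /orP[h|h]]]] := searchP u0 (search_tail hctx) w g'.
- by rewrite size_nseq; lia.
- by rewrite size_nseq.
- have w1 : window u k ctx word_p.
    by split; [case: w|case: (window_sub (prefix0s l) h w')].
  have w2 : window u (k + 12) (rev word_p) [::].
    have := window_shiftR (isT : (12 <= size word_p)%N) w1.
    by apply: window_sub => //; apply: prefix_prefix.
  have v := IH _ _ (or_introl erefl) w2.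
  rewrite (window_fwd u0 R w1) exprSr.
  apply: fixpoint_upper; first by have /andP[] := V_itv (k + 12).
    by apply: v; apply: good_sub g; lia.
  by rewrite exprn_ge0 // invr_ge0.
- have [_ pr] := positive_window u0 w'.
  have [_ p1 _ /andP[_ h1]] := word_boundP pr (V_itv (k + (size r)%:Z)).
  have Pp : positive_word (word_p ++ word_p ++ word_p) by [].
  have [p2 _ _ /andP[h2 _]] := word_boundP Pp periodic_tail_itv.
  move: h2; rewrite 2!cf_word_cat !periodic_tail_fix => h2.
  rewrite (window_fwd u0 R w'); apply: (le_trans h1).
  apply: (le_trans (frac_leP R p1 p2 h)); apply: (le_trans h2).
  by rewrite lerDl exprn_ge0 // invr_ge0.
Qed.

Definition beta : R := 2 + cf_word [:: 1%N] Y + cf_word A_left Y.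

Lemma A_lower n u k : positive_sequence u -> A_at u k ->
  good R u (k - (12 * n)%N%:Z - 100) (k + (12 * n)%N%:Z + 100) ->
  beta - 2 * 4^-1 ^+ n <= perron_lambda R u k.
Proof.
move=> u0 w g; have e0 : 0 <= 4^-1 ^+ n :> R by rewrite exprn_ge0 // invr_ge0.
have V_itv v k' : positive_sequence v -> 0 <= cf_tail R (fwd v k').
  by move=> v0; have /andP[] := @cf_tail_itv R (fwd v k') (fun i => v0 _).
have hr : cf_word [:: 1%N] Y - 4^-1 ^+ n <= cf_tail R (fwd u (k + 1)).
  have /window_next w1 := w.
  (* The right side reads $1\,p$ before its unknown tail. The fixed point absorbs this $p$, and the
     word has odd length 13. *)
  rewrite (window_fwd u0 R w1) -[in X in X <= _]periodic_tail_fix -cf_word_cat.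
  apply: odd_word_lower => //; first exact: V_itv.
  apply: tail_bound u0 (or_introl erefl) _ _.
    have := window_shiftR (isT : (13 <= size (behead A_right))%N) w1.
    by apply: window_sub => //; apply: prefix_prefix.
  by apply: good_sub g; rewrite /=; lia.
have hl : cf_word A_left Y - 4^-1 ^+ n <= cf_tail R (bwd u (k - 1)).
  rewrite (window_bwd u0 R w); apply: odd_word_lower => //.
    by have /andP[] := @cf_tail_itv R (bwd u (k - 1 - 17)) (fun i => u0 _).
  (* The left tail becomes a right tail of the reflected sequence. *)
  have -> : cf_tail R (bwd u (k - 1 - 17)) = cf_tail R (fwd (flip u) (- (k - 17) + 1)).
    by apply: eq_cf_tail => i; rewrite /bwd /fwd /flip; congr u; lia.
  apply: (tail_bound (positive_flip u0) (or_intror erefl)).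
    have w2 := window_shiftL (isT : (17 <= size A_left)%N) w.
    have := proj2 (window_flip u (k - 17) (behead (rev A_left ++ A_right)) 2 [::]) w2.
    by move/window_next.
  have := good_flip u0 g; apply: good_sub; lia.
rewrite lambdaE // -(window_head w) /beta; lra.
Qed.

End tail.

(** * Forced periodicity *)

Definition Q_repeat (m : nat) : seq nat := flatten (nseq m (take 7 Q_right)) ++ Q_right.

Lemma Q_chain_window u m k : (forall i, (i <= m)%N -> Q_at u (k + (7 * i)%N%:Z)) ->
  window u k Q_left (Q_repeat m).
Proof.
elim: m k => [|m IH] k h; first by have := h 0%N isT; rewrite addr0.
have h0 : window u k Q_left (take 7 Q_right).
  by have := h 0%N isT; rewrite muln0 addr0; apply: window_sub.
rewrite /Q_repeat /= -/(Q_repeat m); apply: (window_catR h0).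
have w : window u (k + 7) Q_left (Q_repeat m).
  apply: IH => i im; have := h i.+1 im.
  by rewrite (_ : k + (7 * i.+1)%N%:Z = k + 7 + (7 * i)%N%:Z) //; lia.
exact: window_sub (prefix0s Q_left) (prefix_refl _) w.
Qed.

(** One full period of positions, four periods deep, so that enough letters are known on both sides;
    by periodicity this covers all later positions. *)
Lemma Q_repeat_low : all (fun i => frac_le
    (window_high (rev (take (28 + i) (Q_repeat 8)) ++ Q_left)
                 (drop (28 + i) (Q_repeat 8))) alpha_low) (iota 0 7).
Proof. by vm_compute. Qed.

Section periodic.
Variables (R : realType) (u : int -> nat) (n : nat) (b : R).
Hypothesis u_gt0 : positive_sequence u.
Hypothesis b_lt : b <= beta R - 2 * 4^-1 ^+ n.

Definition good_below (a c : int) : Prop :=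
  good R u a c /\ forall i, a <= i <= c -> perron_lambda R u i < b.

Lemma good_below_sub a c a' c' :
  a <= a' -> c' <= c -> good_below a c -> good_below a' c'.
Proof.
by move=> ? ? [g h]; split=> [|i ?]; [apply: good_sub g|apply: h; lia].
Qed.

(** [A_lower] would push $\lambda_k$ up to [b]. The margin $12n$ is the room for reading $n$ copies
    of $p$ on each side. *)
Lemma no_A_at k :
  good_below (k - (12 * n)%N%:Z - 100) (k + (12 * n)%N%:Z + 100) -> ~ A_at u k.
Proof.
move=> [g h] /(A_lower u_gt0) /(_ g) h2.
have h1 : perron_lambda R u k < b by apply: h; lia.
by have := le_trans b_lt h2; rewrite leNgt h1.
Qed.

Lemma Q_at_step k :
  good_below (k - (12 * n)%N%:Z - 200) (k + (12 * n)%N%:Z + 200) ->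
  Q_at u k -> Q_at u (k + 7).
Proof.
move=> g /(Q_at_next u_gt0 (R := R)) [|//|].
  by case: g => g _; apply: good_sub g; lia.
by move/no_A_at; case; apply: good_below_sub g; lia.
Qed.

Lemma Q_at_chain m k :
  good_below (k - (12 * n)%N%:Z - 200) (k + (7 * m)%N%:Z + (12 * n)%N%:Z + 200) ->
  Q_at u k -> Q_at u (k + (7 * m)%N%:Z).
Proof.
elim: m k => [|m IH] k g q; first by rewrite muln0 addr0.
have -> : k + (7 * m.+1)%N%:Z = k + 7 + (7 * m)%N%:Z by lia.
apply: IH; first by apply: good_below_sub g; lia.
by apply: Q_at_step q; apply: good_below_sub g; lia.
Qed.

Lemma Q_at_low k j : Q_at u k -> k + 28 <= j ->
  good_below (k - (12 * n)%N%:Z - 200) (j + (12 * n)%N%:Z + 300) ->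
  perron_lambda R u j <= fracN R alpha_low.
Proof.
(* Division by 7 finds the (Q) centre whose window contains [j] at depth 28 plus the remainder. *)
move=> q kj g; pose d := absz (j - k - 28)%R.
have ed : j = k + (7 * (d %/ 7))%N%:Z + (28 + d %% 7)%N%:Z by rewrite /d; lia.
have w : window u (k + (7 * (d %/ 7))%N%:Z) Q_left (Q_repeat 8).
  apply: Q_chain_window => i i8; rewrite -addrA -PoszD -mulnDr.
  by apply: Q_at_chain q; apply: good_below_sub g; lia.
have r7 : (d %% 7 < 7)%N by rewrite ltn_mod.
have := allP Q_repeat_low (d %% 7)%N; rewrite mem_iota => /(_ r7) h.
have := window_shiftR (n := (28 + d %% 7)%N) _ w; rewrite -ed.
have s69 : size (Q_repeat 8) = 69%N by [].
rewrite s69 => /(_ ltac:(lia)).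
move: h; case e : (drop _ _) => [|c r].
  by have := congr1 size e; rewrite size_drop s69 /=; lia.
move=> h w1; have [_ p1 _ h1] := window_bounds u_gt0 R w1.
apply: (le_trans h1); exact: (@frac_leP R _ alpha_low).
Qed.

End periodic.

Lemma good_below_flip (R : realType) u (b : R) a c : positive_sequence u ->
  good_below u b a c -> good_below (flip u) b (- c) (- a).
Proof.
move=> u0 [g h]; split=> [|i hi]; first exact: good_flip.
by rewrite lambda_flip //; apply: h; lia.
Qed.

(* The middle peak forces periodicity all the way to one of the outer two. *)
Lemma no_three_peaks (R : realType) u n (b : R) (N k1 k2 k3 : int) :
  positive_sequence u -> b <= beta R - 2 * 4^-1 ^+ n ->
  (forall a c, N <= a -> good_below u b a c) ->
  N + (12 * n)%N%:Z + 400 <= k1 -> k1 + (12 * n)%N%:Z + 400 <= k2 -> k2 + 28 <= k3 ->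
  fracN R alpha_low < perron_lambda R u k1 ->
  fracN R alpha_low < perron_lambda R u k2 ->
  fracN R alpha_low < perron_lambda R u k3 -> False.
Proof.
move=> u0 hn gb hk1 hk2 hk3 l1 l2 l3; have v0 := positive_flip u0.
have gbf a c : N <= - c -> good_below (flip u) b a c.
  by move=> Nc; have := good_below_flip u0 (gb (- c) (- a) Nc); rewrite !opprK.
have g2 : good R u (k2 - 40) (k2 + 40).
  by have [|] := gb (k2 - 40) (k2 + 40); first by lia.
case: (central_types u0 g2 l2) => -[q|q].
- have := Q_at_low u0 hn q hk3; rewrite leNgt l3 => h.
  by have // : false by apply: h; apply: gb; lia.
- by apply: (no_A_at u0 hn _ q); apply: gb; lia.
(* After reflection the forced period runs from [k2] back to [k1]. *)
- have hk : - k2 + 28 <= - k1 by lia.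
  have := Q_at_low v0 hn q hk; rewrite lambda_flip // opprK leNgt l1 => h.
  by have // : false by apply: h; apply: gbf; lia.
- by apply: (no_A_at v0 hn _ q); apply: gbf; lia.
Qed.

(** * The sequence giving the point of M *)

(** [Negz j] is $-(j+1)$, so the left half is read outwards from $-1$: eleven letters, then the
    period 121221. *)
Definition theta (i : int) : nat :=
  match i with
  | Posz j => nth 0 [:: 2; 1; 1; 2; 2; 2; 1] (j %% 7)
  | Negz j => if (j < 11)%N then nth 0 [:: 1; 2; 2; 2; 1; 1; 2; 1; 2; 2; 1] j
              else nth 0 [:: 1; 2; 1; 2; 2; 1] ((j - 11) %% 6)
  end%N.

Lemma theta_gt0 : positive_sequence theta.
Proof.
have nth_gt0 s i : all (leq 1) s -> (i < size s)%N -> (0 < nth 0 s i)%N.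
  by move=> /(all_nthP 0%N) h /h.
by case=> j /=; first (by apply: nth_gt0; rewrite ?ltn_mod);
  case: ifP => hj; apply: nth_gt0; rewrite ?ltn_mod.
Qed.

(** $\lambda_0(\theta)$ cut off after ten decimals. *)
Definition point_low : N * N := (32930443903%num, 10000000000%num).

Definition theta_low (j : int) : bool :=
  frac_le (window_high (mkseq (bwd theta (j - 1)) 24) (mkseq (fwd theta j) 24))
    point_low.

Lemma theta_low_near :
  all (fun i => theta_low i.+1%:Z && theta_low (- i.+1%:Z)) (iota 0 50).
Proof. by vm_compute. Qed.

Lemma theta_periodR (i : int) : 7 <= i -> theta i = theta (i - 7).
Proof.
case: i => // j hj; rewrite -[in LHS](@subnK 7 j); last by lia.
by rewrite (_ : j%:Z - 7 = (j - 7)%N%:Z) /= ?modnDr //; lia.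
Qed.

(** From $-18$ on, the position six places nearer to 0 also lies beyond the eleven preperiodic
    letters. *)
Lemma theta_periodL (i : int) : i <= -18 -> theta i = theta (i + 6).
Proof.
case: i => // j hj; rewrite (_ : Negz j + 6 = Negz (j - 6)) /=; last by lia.
have -> : (j < 11)%N = false by lia.
have -> : (j - 6 < 11)%N = false by lia.
by rewrite (_ : (j - 11 = j - 6 - 11 + 6)%N) ?modnDr //; lia.
Qed.

(** For $|j| \ge 51$ the window lies in a periodic part and may be moved one period towards 0; the
    remaining positions are computed. *)
Lemma theta_low_far (j : int) : j != 0 -> theta_low j.
Proof.
have [n] := ubnP `|j|%N; elim: n j => // n IH j jn j0.
have shift d : (forall i : int, j - 25 < i < j + 25 -> theta i = theta (i + d)) ->
    theta_low j = theta_low (j + d).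
  move=> h; rewrite /theta_low; congr (frac_le (window_high _ _) _).
    apply/eq_in_map => i; rewrite mem_iota => /andP[_ hi].
    by rewrite /bwd h; [congr theta; lia|lia].
  apply/eq_in_map => i; rewrite mem_iota => /andP[_ hi].
  by rewrite /fwd h; [congr theta; lia|lia].
have [jr|jr] := leP 51 j.
  rewrite (shift (-7)); first by apply: IH; lia.
  by move=> i hi; rewrite theta_periodR //; lia.
have [jl|jl] := leP j (-51).
  rewrite (shift 6); first by apply: IH; lia.
  by move=> i hi; rewrite theta_periodL //; lia.
have /(allP theta_low_near)/andP[h1 h2] : (`|j|.-1 \in iota 0 50)%N.
  by rewrite mem_iota; lia.
move: h1 h2; rewrite prednK ?absz_gt0 //.
by case: (ltgtP j 0) j0 => // hj _; [rewrite ltz0_abs // opprK|rewrite gtz0_abs].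
Qed.

Section theta.
Variable R : realType.

(** Identifies a periodic tail with the quadratic irrational solving its fixed point equation. *)
Lemma cf_word_fix_unique l (x y : R) : positive_word l -> (2 <= size l)%N ->
  0 <= x -> 0 <= y -> cf_word l x = x -> cf_word l y = y -> x = y.
Proof.
move=> pl sl x0 y0 ex ey; have := @cf_word_contract _ 1 l x y pl sl x0 y0.
rewrite ex ey expr1 => h; apply/eqP; rewrite -subr_eq0 -normr_eq0.
by have := normr_ge0 (x - y); lra.
Qed.

Lemma sqrt_87 : let s : R := Num.sqrt 87%:R in
  [/\ 9 <= s, s <= 10 & s * s = 87%:R].
Proof. by apply: sqrt_itv; lra. Qed.

Lemma sqrt_18229 : let s : R := Num.sqrt 18229%:R in
  [/\ 135 <= s, s <= 136 & s * s = 18229%:R].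
Proof. apply: sqrt_itv; lra. Qed.

Lemma theta_fwd_value :
  cf_tail R (fwd theta 1) = (Num.sqrt 18229%:R - 87) / 82.
Proof.
have w : window theta 1 [::] [:: 1; 1; 2; 2; 2; 1; 2]%N by [].
have e : cf_tail R (fwd theta (1 + 7)) = cf_tail R (fwd theta 1).
  by apply: eq_cf_tail => i; rewrite /fwd theta_periodR; [congr theta|]; lia.
have /andP[v0 _] := @cf_tail_itv R (fwd theta 1) (fun i => theta_gt0 _).
have := window_fwd theta_gt0 R w; rewrite e => ev.
have [] := sqrt_18229; move: (Num.sqrt _) => s h1 h2 h3.
(* The positive root of $41 z^2 + 87 z - 65 = 0$. *)
have z0 : 0 <= (s - 87) / 82 by lra.
apply: (cf_word_fix_unique _ _ v0 z0 (esym ev)) => //.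
move: z0; set z := _ / _ => z0.
have -> : cf_word [:: 1; 1; 2; 2; 2; 1; 2]%N z = (65 + 24 * z) / (111 + 41 * z).
  by rewrite /=; field; repeat (apply/andP; split); apply/eqP; lra.
apply/(canLR (mulfK _)); first by apply/eqP; lra.
by rewrite /z; lra.
Qed.

Lemma theta_bwd_value : cf_tail R (bwd theta (-1)) = (31 + Num.sqrt 87%:R) / 57.
Proof.
have e : cf_tail R (bwd theta (-12 - 6)) = cf_tail R (bwd theta (-12)).
  by apply: eq_cf_tail => i; rewrite /bwd theta_periodL; [congr theta|]; lia.
have w : window theta (-11) [:: 1; 2; 1; 2; 2; 1]%N [::] by [].
have w' : window theta 0 [:: 1; 2; 2; 2; 1; 1; 2; 1; 2; 2; 1]%N [::] by [].
have /andP[v0 _] := @cf_tail_itv R (bwd theta (-12)) (fun i => theta_gt0 _).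
have ev := window_bwd theta_gt0 R w; rewrite e in ev.
rewrite (window_bwd theta_gt0 R w').
have [] := sqrt_87; move: (Num.sqrt _) => s h1 h2 h3.
(* The positive root of $26 z^2 + 18 z - 27 = 0$, whose discriminant is $36 \cdot 87$. *)
have z0 : 0 <= (3 * s - 9) / 26 by lra.
have -> : cf_tail R (bwd theta (-12)) = (3 * s - 9) / 26.
  apply: (cf_word_fix_unique _ _ v0 z0 (esym ev)) => //.
  move: z0; set z := _ / _ => z0.
  have -> : cf_word [:: 1; 2; 1; 2; 2; 1]%N z = (27 + 19 * z) / (37 + 26 * z).
    by rewrite /=; field; repeat (apply/andP; split); apply/eqP; lra.
  apply/(canLR (mulfK _)); first by apply/eqP; lra.
  by rewrite /z; lra.
move: z0; set z := _ / 26 => z0.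
have -> : cf_word [:: 1; 2; 2; 2; 1; 1; 2; 1; 2; 2; 1]%N z =
          (953 + 670 * z) / (1347 + 947 * z).
  by rewrite /=; field; repeat (apply/andP; split); apply/eqP; lra.
apply/(canLR (mulfK _)); first by apply/eqP; lra.
by rewrite /z; lra.
Qed.

Definition markov_point : R :=
  2 + (Num.sqrt 18229%:R - 87) / 82 + (31 + Num.sqrt 87%:R) / 57.

Lemma markov_point_lambda : perron_lambda R theta 0 = markov_point.
Proof. by rewrite (lambdaE theta_gt0) theta_fwd_value theta_bwd_value. Qed.

(** Variables replace the three square roots, since the identity is linear in them. *)
Lemma delta0_linear (a b c : R) :
  (272052036746460995%:R - 3973474319367040%:R * a
   - 2762049221999040%:R * b + 353887557067187%:R * c) / 226488036203921280%:R
  = 2 + (c - 15) / 640 + (321405190311%:R + c) / 454284411513%:R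
    - (2 + (b - 87) / 82 + (31 + a) / 57).
Proof. lra. Qed.

Lemma betaE :
  beta R = 2 + (Num.sqrt 151905%:R - 15) / 640
             + (321405190311%:R + Num.sqrt 151905%:R) / 454284411513%:R.
Proof.
rewrite /beta A_left_value; congr (2 + _ + _).
rewrite /periodic_tail /=; have [] := sqrt_151905 R; move: (Num.sqrt _) => s h1 h2 h3.
have -> : (1 + (s - 222) / 237)^-1 = 237 / (s + 15).
  by field; repeat (apply/andP; split); apply/eqP; lra.
(* Rationalised by $s^2 - 15^2 = 151680 = 237 \cdot 640$. *)
by apply/(canLR (mulfK _)); [apply/eqP; lra|lra].
Qed.

Lemma delta0E : delta0 R = beta R - markov_point.
Proof. by rewrite betaE; exact: delta0_linear. Qed.

End theta.

(** * Numerical comparisons and conclusion *)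

Section numeric.
Variable R : realType.

(* The digits are split so that no large number is ever converted to unary. *)
Definition decimal10 (a b c : nat) : N * N :=
  (N.add (N.mul (N.add (N.mul (N.of_nat a) (N.mul 100 100)) (N.of_nat b)) 1000)
     (N.of_nat c),
   N.mul 1000 (N.mul (N.mul 100 100) 1000))%num.

Lemma fracN_decimal10 (a b c : nat) :
  fracN R (decimal10 a b c) =
  a%:R / 1000 + b%:R / (1000 * (100 * 100)) +
  c%:R / (1000 * (100 * 100) * 1000).
Proof.
rewrite /fracN /decimal10; cbn [fst snd].
rewrite !(N_to_natD, N_to_natM) !Nat2N.id !(natrD, natrM).
have -> : (N.to_nat 1000%num)%:R = 1000 :> R by [].
have -> : (N.to_nat 100%num)%:R = 100 :> R by [].
rewrite !invfM; lra.
Qed.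

Lemma beta_upE : fracN R beta_up = 3293 / 1000 + 444 / 10000000%:R + 820 / 10000000000%:R.
Proof.
have -> : beta_up = decimal10 3293 444 820 by [].
by rewrite fracN_decimal10; lra.
Qed.

Lemma beta_up_lt : fracN R beta_up < 7 / 2.
Proof. by rewrite beta_upE; lra. Qed.

Lemma alpha_lowE : fracN R alpha_low = 3293 / 1000 + 442 / 10000000%:R + 992 / 10000000000%:R.
Proof.
have -> : alpha_low = decimal10 3293 442 992 by [].
by rewrite fracN_decimal10; lra.
Qed.

Lemma point_lowE : fracN R point_low = 3293 / 1000 + 443 / 10000000%:R + 903 / 10000000000%:R.
Proof.
have -> : point_low = decimal10 3293 443 903 by [].
by rewrite fracN_decimal10; lra.
Qed.

(** The directions bound [markov_point] from below, [beta] from above, and thus $\alpha$, which is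
    twice [markov_point] minus [beta], from below. *)
Lemma sqrt_bounds :
  [/\ 93273790530888%:R / 10000000000000%:R <= Num.sqrt 87%:R :> R,
      1350148140020197%:R / 10000000000000%:R <= Num.sqrt 18229%:R :> R &
      Num.sqrt 151905%:R <= 3897499198203895%:R / 10000000000000%:R :> R].
Proof.
split.
- apply: sqrt_lower; lra.
- apply: sqrt_lower; lra.
- apply: sqrt_upper; lra.
Qed.

Lemma beta_up_gt : beta R < fracN R beta_up.
Proof.
rewrite betaE beta_upE; have [_ _] := sqrt_bounds.
move: (Num.sqrt _) => s h; lra.
Qed.

Lemma point_low_le : fracN R point_low <= markov_point R.
Proof.
have num (a b : R) : 93273790530888%:R / 10000000000000%:R <= a ->
    1350148140020197%:R / 10000000000000%:R <= b ->
    3293 / 1000 + 443 / 10000000%:R + 903 / 10000000000%:R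
    <= 2 + (b - 87) / 82 + (31 + a) / 57 by lra.
by rewrite point_lowE; have [h1 h2 _] := sqrt_bounds; exact: num h1 h2.
Qed.

Lemma alpha_low_le : fracN R alpha_low <= markov_point R - delta0 R.
Proof.
have num (a b c : R) : 93273790530888%:R / 10000000000000%:R <= a ->
    1350148140020197%:R / 10000000000000%:R <= b ->
    c <= 3897499198203895%:R / 10000000000000%:R ->
    3293 / 1000 + 442 / 10000000%:R + 992 / 10000000000%:R
    <= 2 + (b - 87) / 82 + (31 + a) / 57
       - (2 + (c - 15) / 640 + (321405190311%:R + c) / 454284411513%:R
          - (2 + (b - 87) / 82 + (31 + a) / 57)) by lra.
rewrite alpha_lowE delta0E betaE; have [h1 h2 h3] := sqrt_bounds.
exact: num h1 h2 h3.
Qed.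

End numeric.

(** * Limits superior and the exclusion of Lagrange values *)

Lemma limn_esup_lt (R : realType) (f : nat -> R) (x b : R) :
  limn_esup (fun k => (f k)%:E) = x%:E -> x < b ->
  exists N, forall k, (N <= k)%N -> f k < b.
Proof.
move=> e xb; have : (limn_esup (fun k => (f k)%:E) < b%:E)%E by rewrite e lte_fin.
move=> /ereal_inf_lt[_ [V [N _ NV] <-] hV]; exists N => k Nk.
rewrite -lte_fin; apply: le_lt_trans hV; apply: ereal_sup_ubound.
by exists k => //; apply: NV.
Qed.

Lemma limn_esup_gt (R : realType) (f : nat -> R) (x a : R) (N : nat) :
  limn_esup (fun k => (f k)%:E) = x%:E -> a < x ->
  exists2 k, (N <= k)%N & a < f k.
Proof.
move=> e ax; have : (a%:E < ereal_sup [set (f k)%:E | k in [set k | (N <= k)%N]])%E.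
  apply: (@lt_le_trans _ _ x%:E); first by rewrite lte_fin.
  rewrite -e; apply: ereal_inf_lbound.
  by exists [set k | (N <= k)%N] => //; exists N.
move=> /ereal_sup_gt[_ [k Nk <-]]; rewrite lte_fin => ak.
by exists k.
Qed.

(** A letter above 3 already exceeds the bound. Next to a letter 3 both neighbours are at most 3, so
    each tail is at least $1/4$ and $\lambda_k \ge 7/2$. Starting at $N+1$ keeps the left neighbour
    in range. *)
Lemma small_letters (R : realType) (u : int -> nat) (N : int) :
  positive_sequence u ->
  (forall k : int, N <= k -> perron_lambda R u k < 7 / 2) ->
  forall k : int, N + 1 <= k -> u k = 1%N \/ u k = 2%N.
Proof.
move=> u0 h.
have Vf k : 0 <= cf_tail R (fwd u k) <= 1 by apply: cf_tail_itv => i; apply: u0.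
have Vb k : 0 <= cf_tail R (bwd u k) <= 1 by apply: cf_tail_itv => i; apply: u0.
have le3 (k : int) : N <= k -> (u k <= 3)%N.
  move=> /h; rewrite lambdaE // leqNgt => hk; apply/negP => u4.
  have u4' : 4 <= (u k)%:R :> R by rewrite (ler_nat _ 4).
  by have := Vf (k + 1); have := Vb (k - 1); lra.
move=> k Nk; have := le3 k; have := u0 k.
case e : (u k) => [|[|[|[|m]]]] // _; [by left|by right| |by move=> /(_ ltac:(lia))].
move=> _; have /h : N <= k by lia.
have fourth (a : nat) (t : R) : (0 < a <= 3)%N -> 0 <= t <= 1 -> 1 / 4 <= (a%:R + t)^-1.
  move=> /andP[a0 a3] /andP[t0 t1].
  have : a%:R <= 3 :> R by rewrite (ler_nat _ _ 3).
  have : 1 <= a%:R :> R by rewrite ler1n.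
  by move=> a1 a3'; rewrite div1r lef_pV2 ?posrE; lra.
rewrite lambdaE // e.
have : 1 / 4 <= cf_tail R (fwd u (k + 1)).
  rewrite cf_tail_cons /fwd; last by move=> i; apply: u0.
  apply: fourth; last by apply: cf_tail_itv => i; apply: u0.
  by rewrite u0 /=; apply: le3; lia.
have : 1 / 4 <= cf_tail R (bwd u (k - 1)).
  rewrite cf_tail_cons /bwd; last by move=> i; apply: u0.
  apply: fourth; last by apply: cf_tail_itv => i; apply: u0.
  by rewrite u0 /=; apply: le3; lia.
by move=> h1 h2; rewrite ltNge => /negP[]; lra.
Qed.

(** The supremum is attained at position 0: all other positions stay below [point_low]. *)
Lemma markov_point_mem (R : realType) : markov_spectrum R (markov_point R).
Proof.
exists theta; split; first exact: theta_gt0.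
apply/eqP; rewrite eq_le; apply/andP; split; last first.
  by apply: ereal_sup_ubound; exists 0 => //; rewrite markov_point_lambda.
apply: ge_ereal_sup => _ [j _ <-]; rewrite lee_fin.
have [->|j0] := eqVneq j 0; first by rewrite markov_point_lambda.
have w : window theta j (mkseq (bwd theta (j - 1)) 24) (mkseq (fwd theta j) 24).
  by split; rewrite size_mkseq.
have h := theta_low_far j0.
have [_ p _ h1] := window_bounds theta_gt0 R w.
apply: (le_trans h1); apply: le_trans (point_low_le R).
exact: (@frac_leP R _ point_low).
Qed.

Lemma lagrange_far (R : realType) (x : R) :
  lagrange_spectrum R x -> delta0 R <= `|x - markov_point R|.
Proof.
move=> [u [u0 ux]]; rewrite leNgt; apply/negP => xm.
(* As [delta0] is [beta] minus [markov_point], the forbidden interval around that point is exactly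
   $(\alpha, \beta)$. *)
have xbeta : x < beta R by have := delta0E R; move: xm; rewrite ltr_norml; lra.
have alphax : fracN R alpha_low < x.
  by have := alpha_low_le R; move: xm; rewrite ltr_norml; lra.
(* The midpoint leaves $(\beta - x)/2$ on either side: one half for the limsup, the other for the
   error $2 \cdot 4^{-n}$. *)
pose b := (x + beta R) / 2.
have xb : x < b by rewrite /b; lra.
have [n hn] : exists n, b <= beta R - 2 * 4^-1 ^+ n.
  have q : `|4^-1 : R| < 1 by rewrite ger0_norm; lra.
  have e0 : 0 < (beta R - x) / 4 by lra.
  have /cvgrPdist_lt /(_ _ e0) [n _ /(_ n (leqnn n))] := cvg_expr q.
  rewrite sub0r normrN ger0_norm ?exprn_ge0 ?invr_ge0 // => h.
  by exists n; rewrite /b; lra.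
have [N hN] := limn_esup_lt ux xb.
have below (k : int) : N%:Z <= k -> perron_lambda R u k < b.
  case: k => [k|k] Nk; last by lia.
  exact: (hN k Nk).
have b_up : b < fracN R beta_up.
  apply: lt_trans (beta_up_gt R); rewrite /b; lra.
have letters (k : int) : N%:Z + 1 <= k -> u k = 1%N \/ u k = 2%N.
  apply: (@small_letters R u N%:Z u0) => i Ni.
  exact: lt_trans (below _ Ni) (lt_trans b_up (beta_up_lt R)).
have gb a c : N%:Z + 1 <= a -> good_below u b a c.
  move=> Na; split=> i hi; last by apply: below; lia.
  by split; [apply: letters; lia|apply: lt_trans b_up; apply: below; lia].
have [k1 k1N l1] := limn_esup_gt (N + 1 + 12 * n + 400)%N ux alphax.
have [k2 k2N l2] := limn_esup_gt (k1 + 12 * n + 400)%N ux alphax.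
have [k3 k3N l3] := limn_esup_gt (k2 + 28)%N ux alphax.
apply: (no_three_peaks u0 hn gb _ _ _ l1 l2 l3).
- by move: k1N; clear; lia.
- by move: k2N; clear; lia.
- by move: k3N; clear; lia.
Qed.

Theorem theorem1p6 (R : realType) :
  ((delta0 R)%:E <= hausdorff_dist (lagrange_spectrum R) (markov_spectrum R))%E.
Proof.
rewrite /hausdorff_dist le_max; apply/orP; right.
apply: (@le_trans _ _ (set_dist (lagrange_spectrum R) (markov_point R))); last first.
  by apply: ereal_sup_ubound; exists (markov_point R) => //; exact: markov_point_mem.
by apply: le_ereal_inf_tmp => _ [x Lx <-]; rewrite lee_fin; apply: lagrange_far.
Qed.
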